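(* Let $n\geq 8$ be an integer, and for $k\in\mathbb{N}$ with $1\le k\le [\frac{n}{2}]-1$ let $\Gamma=Cay(\mathbb{Z}_n,S_k)$ be the Cayley graph on the cyclic group $\mathbb{Z}_n$, where $S_1=\{1,n-1\}$, ..., $S_k=S_{k-1}\cup\{k,n-k\}$ are inverse closed subsets of $\mathbb{Z}_n-\{0\}$. If $n$ is an even integer and $k=\frac{n}{2}-1$, then the strong metric dimension of $\Gamma$ is $k+1$.
   Context: $[x]$ denotes the integer part of $x$. For a finite group $G$ and a subset $\Omega\subseteq G$ closed under inverses and not containing the identity, the Cayley graph $Cay(G,\Omega)$ has vertex set $G$ and edge set $\{\{x,y\} : x^{-1}y\in\Omega\}$ (for the additive group $\mathbb{Z}_n$, $x^{-1}y$ means $y-x$). For a finite connected graph $\Gamma$, a vertex $w$ strongly resolves two vertices $u$ and $v$ if $u$ belongs to a shortest $v-w$ path or $v$ belongs to a shortest $u-w$ path. A set $N$ of vertices is a strong resolving set of $\Gamma$ if every two distinct vertices of $\Gamma$ are strongly resolved by some vertex of $N$. The strong metric dimension $sdim(\Gamma)$ is the minimum cardinality of a strong resolving set of $\Gamma$. *)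

(* Defs.v *)
From mathcomp Require Import all_boot all_fingroup all_algebra.
From mathcomp Require Import zify.

Set Implicit Arguments.
Unset Strict Implicit.
Unset Printing Implicit Defensive.

(** Graphs are adjacency relations [e : rel T] on a finite type.  A walk from
    [x] is written [x :: p], as in mathcomp's [path]; its length is [size p]. *)

Section Graph.
Variables (T : finType) (e : rel T).

Definition is_path (x y : T) (p : seq T) : bool :=
  path e x p && (last x p == y).

Definition shortest_path (x y : T) (p : seq T) : bool :=
  is_path x y p &&
  [forall d : 'I_(size p), forall q : d.-tuple T, ~~ is_path x y q].

(* Shortest paths repeat no vertex, so bounding the length by #|T| loses
   nothing; see [on_shortest_pathP]. *)
Definition on_shortest_path (u x y : T) : bool :=
  [exists d : 'I_#|T|, exists p : d.-tuple T,
     shortest_path x y p && (u \in x :: p)].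

Definition strongly_resolves (w u v : T) : bool :=
  on_shortest_path u v w || on_shortest_path v u w.

Definition strong_resolving_set (N : {set T}) : bool :=
  [forall u : T, forall v : T,
     (u != v) ==> [exists w : T, (w \in N) && strongly_resolves w u v]].

(* The default [setT] of [arg min] is itself strong resolving when the graph
   is connected, so this is a genuine minimum then; see [sdimP]. *)
Definition sdim : nat :=
  #|[arg min_(N < [set: T] | strong_resolving_set N) #|N|]|.

Lemma shortest_pathP x y p :
  reflect (is_path x y p /\ forall q, is_path x y q -> size p <= size q)
          (shortest_path x y p).
Proof.
apply: (iffP andP) => -[pP min_p]; split=> //.
  move=> q qP; rewrite leqNgt; apply/negP => lt_qp.
  by move/forallP/(_ (Ordinal lt_qp))/forallP/(_ (in_tuple q)): min_p; rewrite qP.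
apply/forallP => d; apply/forallP => q; apply/negP => /min_p.
by rewrite size_tuple leqNgt ltn_ord.
Qed.

Lemma shortest_path_size x y p : shortest_path x y p -> size p < #|T|.
Proof.
case/shortest_pathP => /andP[pP /eqP ly] min_p.
case/shortenP: pP (ly) => q qP uq _ lq.
have /min_p le_pq : is_path x y q by rewrite /is_path qP lq eqxx.
apply: (leq_ltn_trans le_pq).
by have := max_card (mem (x :: q)); rewrite (card_uniqP uq).
Qed.

Lemma on_shortest_pathP u x y :
  reflect (exists2 p, shortest_path x y p & u \in x :: p)
          (on_shortest_path u x y).
Proof.
apply: (iffP existsP) => [[d /existsP[p /andP[pP up]]]|[p pP up]].
  by exists p.
exists (Ordinal (shortest_path_size pP)); apply/existsP.
by exists (in_tuple p); apply/andP.
Qed.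

Lemma shortest_path_exists x y : connect e x y -> exists p, shortest_path x y p.
Proof.
case/connectP => p0 p0P ->.
pose P d := [exists p : d.-tuple T, is_path x (last x p0) p].
have exP : exists d, P d.
  by exists (size p0); apply/existsP; exists (in_tuple p0); rewrite /is_path p0P eqxx.
case: (ex_minnP exP) => d /existsP[p pP] min_d.
exists p; apply/shortest_pathP; split=> // q qP; rewrite size_tuple; apply: min_d.
by apply/existsP; exists (in_tuple q).
Qed.

Lemma strong_resolving_setT :
  (forall x y, connect e x y) -> strong_resolving_set [set: T].
Proof.
move=> conn; apply/forallP => u; apply/forallP => v; apply/implyP => _.
apply/existsP; exists u; rewrite inE; apply/orP; left.
have [p pP] := shortest_path_exists (conn v u).
apply/on_shortest_pathP; exists p => //.
by case/shortest_pathP: pP => /andP[_ /eqP <-] _; apply: mem_last.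
Qed.

Lemma sdimP : (forall x y, connect e x y) ->
  (exists2 N, strong_resolving_set N & #|N| = sdim) /\
  (forall N, strong_resolving_set N -> sdim <= #|N|).
Proof.
move=> /strong_resolving_setT rT; rewrite /sdim.
by case: arg_minnP => // N rN min_N; split=> //; exists N.
Qed.

End Graph.

(* For [gT := 'Z_n], whose group law is addition, [x^-1 * y] is [y - x]. *)
Definition cayley (gT : finGroupType) (Omega : {set gT}) : rel gT :=
  [rel x y | (x^-1 * y)%g \in Omega].

(* Starting from the empty set at 0 makes the stage 1 set {1, n - 1}. *)
Fixpoint Sset (n k : nat) : {set 'Z_n} :=
  if k is k'.+1 then Sset n k' :|: [set (k%:R)%R; ((n - k)%:R)%R] else set0.

Lemma cayley_ZnE n (Omega : {set 'Z_n}) (x y : 'Z_n) :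
  cayley Omega x y = ((y - x)%R \in Omega).
Proof. by rewrite /cayley /= GRing.addrC. Qed.

Lemma Sset1E n : Sset n 1 = [set (1%:R)%R; ((n - 1)%:R)%R].
Proof. by rewrite /= set0U. Qed.

Lemma Sset_inv n k x : 1 < n -> k <= n -> x \in Sset n k -> (x^-1)%g \in Sset n k.
Proof.
move=> n1; elim: k => [|k IH] lekn /=; first by rewrite inE.
have nsub : ((n - k.+1)%:R = - (k.+1)%:R :> 'Z_n)%R.
  by rewrite GRing.natrB // pchar_Zp // GRing.sub0r.
rewrite nsub in_setU in_set2 => /orP[/(IH (ltnW lekn)) xS|]; first by rewrite inE xS.
rewrite in_setU in_set2 => /orP[] /eqP ->; apply/orP; right.
  by rewrite eqxx orbT.
by rewrite [X in X == _]GRing.opprK eqxx.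
Qed.

Lemma Sset_id n k : 1 < n -> k < n -> (1%g : 'Z_n) \notin Sset n k.
Proof.
move=> n1; elim: k => [|k IH] ltkn /=; first by rewrite inE.
rewrite in_setU in_set2 negb_or IH ?(ltnW ltkn) //= negb_or.
have nz m : 0 < m < n -> (1%g : 'Z_n) != (m%:R)%R.
  case/andP=> m0 mn; apply/eqP => /(congr1 val) /=.
  by rewrite val_Zp_nat // modn_small // => m0E; rewrite -m0E in m0.
by apply/andP; split; apply: nz; lia.
Qed.

Lemma cayley_Sset_connect n k (x y : 'Z_n) :
  1 < n -> 0 < k -> connect (cayley (Sset n k)) x y.
Proof.
move=> n1 k0.
have S1 : ((1%:R : 'Z_n) \in Sset n k)%R.
  elim: k k0 => // -[|k] IH _; first by rewrite Sset1E set21.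
  by rewrite [Sset _ _]/= inE IH.
rewrite -[y](GRing.subrK x) -[(y - x)%R]natr_Zp.
elim: (nat_of_ord (y - x)%R) => [|m IH]; first by rewrite GRing.add0r connect0.
apply: connect_trans IH (connect1 _).
by rewrite cayley_ZnE GRing.opprD GRing.addrACA GRing.subrr GRing.addr0 -GRing.nat1r GRing.addrK.
Qed.

(* Main.v *)
Require Import Defs.
From mathcomp Require Import all_boot all_fingroup all_algebra.
From mathcomp Require Import zify.

(** For [k = n/2 - 1] the graph is the cocktail party graph: [x] is adjacent to
    every other vertex except its antipode [x + n/2].  An antipodal pair is
    strongly resolved only by its own two members, so a strong resolving set
    meets all [n/2] antipodal pairs.  Conversely one vertex from each pair is
    enough, because every vertex other than [u] and its antipode lies on a
    shortest path between those two. *)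

Section Resolving.
Variables (T : finType) (e : rel T).
Hypothesis conn : forall x y, connect e x y.

Lemma on_shortest_path_last x y : on_shortest_path e y x y.
Proof.
have [p pP] := shortest_path_exists (conn x y).
apply/on_shortest_pathP; exists p => //.
by case/shortest_pathP: pP => /andP[_ /eqP <-] _; apply: mem_last.
Qed.

Lemma strongly_resolves_left u v : strongly_resolves e u u v.
Proof. by rewrite /strongly_resolves on_shortest_path_last. Qed.

Lemma strongly_resolves_right u v : strongly_resolves e v u v.
Proof. by rewrite /strongly_resolves on_shortest_path_last orbT. Qed.

End Resolving.

(** The edge is itself a path of length 1, so a shortest path has exactly one step and no interior
    vertex. *)
Lemma on_shortest_path_edge {T : finType} {e : rel T} {u x y : T} :
  x != y -> e x y -> on_shortest_path e u x y -> u = x \/ u = y.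
Proof.
move=> nxy exy /on_shortest_pathP[p /shortest_pathP[/andP[_ /eqP ly] min_p]].
have /min_p : is_path e x y [:: y] by rewrite /is_path /= exy eqxx.
case: p ly {min_p} => [|z [|//]] /= ly _; first by rewrite ly eqxx in nxy.
by rewrite ly !inE => /orP[] /eqP; [left|right].
Qed.

Section CocktailParty.
Variables (T : finType) (e : rel T) (s : T -> T).
Hypotheses (sK : involutive s) (s_neq : forall x, s x != x).
Hypothesis eE : forall x y, e x y = (y != x) && (y != s x).
Hypothesis conn : forall x y, connect e x y.

(** [v] is adjacent to both [u] and [s u], giving a path of length 2 through [v]. Length 0 would
    force [s u = u], and length 1 would make antipodes adjacent. *)
Lemma strongly_resolves_antipode u v :
  v != u -> v != s u -> strongly_resolves e (s u) u v.
Proof.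
move=> nvu nvsu; apply/orP; right; apply/on_shortest_pathP.
exists [:: v; s u]; last by rewrite !inE eqxx orbT.
apply/shortest_pathP; split.
  rewrite /is_path /= !eE nvu nvsu eqxx !andbT eq_sym nvsu /=.
  by rewrite (inj_eq (inv_inj sK)) eq_sym.
case=> [|a [|//]] /andP[/= + /eqP la].
  by have := s_neq u; rewrite -la eqxx.
by rewrite la eE eqxx andbF.
Qed.

(** Any other [w] is adjacent to both [u] and [s u], so the shortest paths to [w] are single edges
    and cannot contain the opposite antipode. *)
Lemma strongly_resolves_antipodal_pair w u :
  strongly_resolves e w u (s u) -> w = u \/ w = s u.
Proof.
have [->|nwu] := eqVneq w u; first by left.
have [->|nwsu] := eqVneq w (s u); first by right.
have euw : e u w by rewrite eE nwu nwsu.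
have esuw : e (s u) w by rewrite eE sK nwu nwsu.
have nsuw : s u != w by rewrite eq_sym.
have nuw : u != w by rewrite eq_sym.
case/orP => [/(on_shortest_path_edge nsuw esuw)|/(on_shortest_path_edge nuw euw)].
- case=> [uE|->]; last by left.
  by have := s_neq u; rewrite -uE eqxx.
- case=> [uE|->]; last by right.
  by have := s_neq u; rewrite uE eqxx.
Qed.

Lemma strong_resolving_set_antipodal N u :
  strong_resolving_set e N -> (u \in N) || (s u \in N).
Proof.
move/forallP/(_ u)/forallP/(_ (s u)); rewrite eq_sym s_neq /=.
case/existsP => w /andP[wN /strongly_resolves_antipodal_pair[] wE];
  by rewrite -wE wN ?orbT.
Qed.

(** The member of [N] in the pair of [u] resolves [u] from every [v], whatever [v] is. *)
Lemma antipodal_strong_resolving_set (N : {set T}) :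
  (forall u, (u \in N) || (s u \in N)) -> strong_resolving_set e N.
Proof.
move=> meetN; apply/forallP => u; apply/forallP => v; apply/implyP => nuv.
apply/existsP; have /orP[uN|suN] := meetN u.
  by exists u; rewrite uN strongly_resolves_left.
exists (s u); rewrite suN /=.
have [->|nvsu] := eqVneq v (s u); first exact: strongly_resolves_right.
by apply: strongly_resolves_antipode; rewrite // eq_sym.
Qed.

Lemma sdim_cocktail_party : (sdim e).*2 = #|T|.
Proof.
have [[N0 rN0 N0E] min_sdim] := sdimP conn.
apply/eqP; rewrite eqn_leq; apply/andP; split.
  (* Ranks choose one vertex of each antipodal pair, so [s] exchanges [N] with its complement and
     [N] has half the vertices. *)
  pose N := [set x | enum_rank x < enum_rank (s x)].
  have NC : ~: N = s @: N.
    apply/setP => x; rewrite -{2}(sK x) (mem_imset _ _ (inv_inj sK)) !inE sK.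
    rewrite -leqNgt leq_eqVlt val_eqE (inj_eq enum_rank_inj).
    by rewrite (negPf (s_neq x)).
  have rN : strong_resolving_set e N.
    apply: antipodal_strong_resolving_set => u.
    by rewrite -{1}(sK u) -[s (s u) \in N]negbK -in_setC NC (mem_imset _ _ (inv_inj sK)) orNb.
  have := cardsC N; rewrite NC (card_imset _ (inv_inj sK)) addnn => <-.
  by rewrite leq_double min_sdim.
(* A minimum set [N0] meets every pair, so [N0] and its image under [s] cover the graph. *)
have TE : [set: T] = N0 :|: s @: N0.
  apply/setP => x; rewrite !inE -{2}(sK x) (mem_imset _ _ (inv_inj sK)).
  by rewrite strong_resolving_set_antipodal.
rewrite -N0E -cardsT TE -addnn (leq_trans (leq_card_setU _ _)) //.
by rewrite leq_add2l leq_imset_card.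
Qed.

End CocktailParty.

Lemma eq_Zp_nat n m (x : 'Z_n) : m < n -> 1 < n ->
  (x == (m%:R)%R) = (x == m :> nat).
Proof.
move=> ltmn n1; rewrite -(inj_eq val_inj) [X in _ == X]val_Zp_nat //.
by rewrite modn_small.
Qed.

(** Both intervals are empty at [k = 0]; each stage extends the first upwards and the second
    downwards by one residue. *)
Lemma mem_Sset n k (x : 'Z_n) : 1 < n -> k < n ->
  (x \in Sset n k) = (0 < x <= k) || (n - k <= x < n).
Proof.
move=> n1; have xn : x < n by have := ltn_ord x; rewrite [X in _ < X]Zp_cast.
elim: k => [|k IH] ltkn /=; first by rewrite inE; lia.
rewrite in_setU in_set2 IH ?(ltnW ltkn) // !eq_Zp_nat //; lia.
Qed.

(** The intervals from 1 to [m - 1] and from [m + 1] to [2m - 1] miss only 0 and [m]. *)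
Lemma mem_Sset_half m (x : 'Z_m.*2) : 0 < m ->
  (x \in Sset m.*2 m.-1) = (x != 0%R) && (x != (m%:R)%R).
Proof.
move=> m0; have n1 : 1 < m.*2 by lia.
have xn : x < m.*2 by have := ltn_ord x; rewrite [X in _ < X]Zp_cast.
rewrite mem_Sset // ?(eq_Zp_nat _ 0) ?eq_Zp_nat //; lia.
Qed.

Theorem theorem3p7 (n k : nat) (hn : 8 <= n) (hk1 : 1 <= k)
    (hk : k <= n %/ 2 - 1) (neven : ~~ odd n) (hkn : k = n %/ 2 - 1) :
  sdim (cayley (Sset n k)) = k + 1.
Proof.
have [m nE] : exists m, n = m.*2 by exists n./2; lia.
have {hkn} kE : k = m.-1 by lia.
subst n k; have n1 : 1 < m.*2 by lia.
(* The antipodal map is translation by [h]: an involution as [h + h = 0], without fixed points as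
   [h] is nonzero. *)
pose h : 'Z_m.*2 := (m%:R)%R.
have hh : (h + h = 0)%R by rewrite -GRing.natrD addnn pchar_Zp.
have h0 : h != 0%R by rewrite eq_sym /h eq_Zp_nat //=; lia.
suff : (sdim (cayley (Sset m.*2 m.-1))).*2 = #|'Z_m.*2|.
  by rewrite card_ord Zp_cast //; lia.
apply: (@sdim_cocktail_party _ _ (fun x => x + h)%R).
- by move=> x; rewrite -GRing.addrA hh GRing.addr0.
- by move=> x; rewrite -GRing.subr_eq0 GRing.addrC GRing.addKr.
- move=> x y; rewrite cayley_ZnE mem_Sset_half; last by lia.
  by rewrite GRing.subr_eq0 GRing.subr_eq [(m%:R + x)%R]GRing.addrC.
- by move=> x y; apply: cayley_Sset_connect.
Qed.
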